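(* Consider the contextual search problem in dimension $d$ with the symmetric loss $\ell(\theta,p)=|\theta-p|$. The learner that in every round chooses $p_t$ such that $\mathrm{Vol}(S_t^+(p_t;u_t))=\mathrm{Vol}(S_t^-(p_t;u_t))$ has total loss $\sum_{t=1}^T|\langle u_t,v\rangle-p_t|$ bounded by $2^{O(d\log d)}$, uniformly over $T$, over $v\in[0,1]^d$ and over the adversary.
   Context: Contextual search problem in dimension $d$: an adversary fixes $v\in[0,1]^d$. In each round $t=1,\dots,T$ the adversary chooses a unit vector $u_t\in\mathbb{R}^d$, the learner chooses $p_t\in\mathbb{R}$, incurs loss $\ell(\langle u_t,v\rangle,p_t)$ and learns the sign of $\langle u_t,v\rangle-p_t$. Knowledge sets: $S_1=[0,1]^d$, $S_{t+1}=S_t^+(p_t;u_t):=\{x\in S_t:\langle u_t,x\rangle\ge p_t\}$ if $p_t\le\langle u_t,v\rangle$ was learned, else $S_{t+1}=S_t^-(p_t;u_t):=\{x\in S_t:\langle u_t,x\rangle\le p_t\}$. $\mathrm{Vol}$ denotes $d$-dimensional Lebesgue measure. *)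

(* Defs.v *)
From HB Require Import structures.
From mathcomp Require Import all_boot all_order all_algebra.
From mathcomp Require Import all_classical all_reals all_analysis.

Set Implicit Arguments.
Unset Strict Implicit.
Unset Printing Implicit Defensive.

Import Order.TTheory GRing.Theory Num.Theory.
Import numFieldNormedType.Exports.

Local Open Scope classical_set_scope.
Local Open Scope ring_scope.

(* The alias [sf_prod] carries the sigma-finite structure of [m1 \x m2]: on
   [\x] itself the library registers that instance for subprobabilities first,
   which hides the general one. *)
Section SigmaFiniteProduct.
Local Open Scope ereal_scope.
Context d1 d2 (T1 : measurableType d1) (T2 : measurableType d2) (R : realType).
Variables (m1 : {sigma_finite_measure set T1 -> \bar R})
  (m2 : {sigma_finite_measure set T2 -> \bar R}).

Definition sf_prod := m1 \x m2.

HB.instance Definition _ := Measure.on sf_prod.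

Let sf_prod_sigma_finite : sigma_finite setT sf_prod.
Proof.
have /sigma_finiteP[F [TF ndF Foo]] := sigma_finiteT m1.
have /sigma_finiteP[G [TG ndG Goo]] := sigma_finiteT m2.
exists (fun n => F n `*` G n).
  rewrite -setXTT TF TG predeqE => -[x y]; split.
    move=> [/= [n _ Fnx] [k _ Gky]]; exists (maxn n k) => //; split.
    - by move: x Fnx; exact/subsetPset/ndF/leq_maxl.
    - by move: y Gky; exact/subsetPset/ndG/leq_maxr.
  by move=> [n _ []/= ? ?]; split; exists n.
move=> k; have [? ?] := Foo k; have [? ?] := Goo k.
split; first exact: measurableX.
by rewrite /sf_prod product_measure1E// lte_mul_pinfty// ge0_fin_numE.
Qed.

HB.instance Definition _ :=
  Measure_isSigmaFinite.Build _ _ _ sf_prod sf_prod_sigma_finite.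

End SigmaFiniteProduct.

Section Volume.
Variable R : realType.

Record sf_space := SfSpace {
  sf_disp : measure_display ;
  sf_car : measurableType sf_disp ;
  sf_meas : {sigma_finite_measure set sf_car -> \bar R} }.

(* R * (R * (... * unit)) with n factors R, under the n-fold product of the
   Lebesgue measure on R. *)
Fixpoint lebesgue_space (n : nat) : sf_space :=
  if n is n'.+1 then
    @SfSpace _ (measurableTypeR R * sf_car (lebesgue_space n'))%type
      (sf_prod (@lebesgue_measure R) (sf_meas (lebesgue_space n')))
  else @SfSpace _ unit (@dirac _ unit tt R).

Fixpoint row_of (n : nat) : sf_car (lebesgue_space n) -> 'rV[R]_n :=
  match n return sf_car (lebesgue_space n) -> 'rV[R]_n with
  | 0 => fun=> 0
  | n'.+1 => fun x => (row_mx (x.1)%:M (row_of x.2) : 'rV[R]_(1 + n'))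
  end.

(* n-dimensional Lebesgue measure, transported along the coordinate bijection
   [row_of]; the library's 'rV[R]_n carries no measure. *)
Definition Vol (n : nat) (A : set 'rV[R]_n) : \bar R :=
  sf_meas (lebesgue_space n) (@row_of n @^-1` A).

End Volume.

Section ContextualSearch.
Variables (R : realType) (d : nat).
Implicit Types (S : set 'rV[R]_d) (u v x : 'rV[R]_d) (p : R).

Definition dotv u x : R := \sum_(i < d) u 0 i * x 0 i.

(* Euclidean norm; the library norm on 'rV[R]_d is the sup norm. *)
Definition enorm u : R := Num.sqrt (dotv u u).

Definition unit_cube : set 'rV[R]_d := [set x | forall i, 0 <= x 0 i <= 1].

Definition cut_ge S p u : set 'rV[R]_d := [set x | S x /\ p <= dotv u x].
Definition cut_le S p u : set 'rV[R]_d := [set x | S x /\ dotv u x <= p].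

(* Rounds are numbered from 0, so [knowledge v us ps t] is the knowledge set
   S_(t+1), before the query [us t], [ps t]. *)
Fixpoint knowledge v (us : nat -> 'rV[R]_d) (ps : nat -> R) (t : nat) :
    set 'rV[R]_d :=
  if t is t'.+1 then
    let S := knowledge v us ps t' in
    if ps t' <= dotv (us t') v then cut_ge S (ps t') (us t')
    else cut_le S (ps t') (us t')
  else unit_cube.

End ContextualSearch.

Definition symmetric_loss (R : realType) (theta p : R) : R := `|theta - p|.

(* Main.v *)
(* Volume alone is a poor potential, since a body of tiny volume can still be
   long.  Instead, for each dyadic scale e, follow Vol (S_t + B_r), with B_r an
   open sup-norm box of radius r ~ e / d^2.
   If the cut halves the volume of the convex body S, both sides of the cut have
   depth at least a 1/(4d) fraction of each other (shrink S towards a far point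
   of one side).  Hence, when the loss is at least e, the discarded side reaches
   far beyond the cut compared with r, and a homothety of ratio 1/(16d) centred
   at a point deep in that side maps S + B_r into the part of S + B_r which is
   lost: Vol (S_t + B_r) drops by the factor 1 - (16d)^-d.  As it stays between
   (2r)^d and 4^d, at most d^O(d) * (j + 1) rounds have loss at least
   2d / 2^j, and summing over j gives d^O(d). *)

Require Import Defs.
From HB Require Import structures.
From mathcomp Require Import all_boot all_order all_algebra.
From mathcomp Require Import all_classical all_reals all_analysis.
From mathcomp Require Import measurable_realfun.
From mathcomp Require Import ring lra zify.
Import Order.TTheory GRing.Theory Num.Theory.
Import numFieldNormedType.Exports.
Local Open Scope classical_set_scope.
Local Open Scope ring_scope.
Set Implicit Arguments.
Unset Strict Implicit.
Unset Printing Implicit Defensive.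

(** * Scaling of Lebesgue measure under affine maps *)

Section Volume.
Variable R : realType.

Let affR (a b : R) : measurableTypeR R -> measurableTypeR R := fun x => a * x + b.

Let affR_meas (a b : R) : measurable_fun setT (affR a b).
Proof.
by apply: measurable_funD => //; apply: measurable_funM.
Qed.

(** The rescaled pushforward agrees with Lebesgue measure on half-open intervals, and these
    determine it. *)
Lemma lebesgue_measure_affine (a b : R) (A : set R) : 0 < a ->
  measurable (A : set (measurableTypeR R)) ->
  (a%:E * lebesgue_measure ((fun x => (a * x + b)%R) @^-1` A) =
   lebesgue_measure A)%E.
Proof.
move=> a0 mA.
have an : 0 <= a := ltW a0.
pose nu : measure (measurableTypeR R) R :=
  mscale (NngNum an) (pushforward (@lebesgue_measure R) (affR a b)).
pose mu' := nu (affR_meas a b).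
suff E X : ocitv X -> lebesgue_measure X = mu' X.
  exact/esym/(lebesgue_measure_unique E mA).
move=> [[x y]/= _ <-].
change (lebesgue_measure `]x, y] =
  a%:E * lebesgue_measure (affR a b @^-1` `]x, y]))%E.
have -> : affR a b @^-1` [set` `]x, y]] = [set` `](x - b) / a, (y - b) / a]].
  apply/seteqP; split => z /=; rewrite !in_itv/= /affR ltr_pdivrMr// ler_pdivlMr//.
    by rewrite ltrBlDr lerBrDr mulrC.
  by rewrite ltrBlDr lerBrDr mulrC.
rewrite !lebesgue_measure_itv/= !lte_fin ltr_pM2r ?invr_gt0// ltrD2r.
case: ifP => _; last by rewrite mule0.
rewrite -!EFinD -EFinM; congr (_%:E)%E; field.
by rewrite gt_eqF.
Qed.

(** The map [y => a *: y + b] read through [row_of]; nested pairs allow induction on the number of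
    factors. *)
Fixpoint aff_space (a : R) (n : nat) :
    'rV[R]_n -> sf_car (lebesgue_space R n) -> sf_car (lebesgue_space R n) :=
  match n return 'rV[R]_n -> sf_car (lebesgue_space R n) -> sf_car (lebesgue_space R n) with
  | 0 => fun _ x => x
  | n'.+1 => fun b x =>
     (a * x.1 + b 0 0, aff_space a (\row_j b 0 (lift 0 j)) x.2)
  end.

Lemma row_of_ord0 n (x : sf_car (lebesgue_space R n.+1)) : row_of x 0 0 = x.1.
Proof.
rewrite /= mxE; case: splitP => //= j _.
by rewrite !ord1 mxE eqxx mulr1n.
Qed.

Lemma row_of_lift n (x : sf_car (lebesgue_space R n.+1)) (i : 'I_n) :
  row_of x 0 (lift 0 i) = row_of x.2 0 i.
Proof.
rewrite /= mxE; case: splitP => [j /= /eqP|k].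
  by rewrite ord1.
by rewrite /= /bump /= add1n => -[/val_inj ->].
Qed.

Lemma row_of_aff_space a n (b : 'rV[R]_n) x :
  row_of (aff_space a b x) = a *: row_of x + b.
Proof.
elim: n b x => [|n IH] b x; first by apply/rowP => -[].
have E (y : 'rV[R]_n.+1) i : (a *: y + b) 0 i = a * y 0 i + b 0 i.
  by rewrite !mxE.
apply/rowP => i; rewrite E.
case: (unliftP 0 i) => [j|] ->; last by rewrite !row_of_ord0.
by rewrite !row_of_lift IH !mxE.
Qed.

Lemma aff_space_measurable a n (b : 'rV[R]_n) :
  measurable_fun setT (aff_space a b).
Proof.
elim: n b => [|n IH] b /=; first exact: measurable_id.
apply/measurable_fun_pairP; split.
  exact: measurableT_comp (affR_meas a (b 0 0)) measurable_fst.
exact: measurableT_comp (IH _) measurable_snd.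
Qed.

Lemma sf_measX n (X : set R) (Y : set (sf_car (lebesgue_space R n))) :
  measurable (X : set (measurableTypeR R)) -> measurable Y ->
  sf_meas (lebesgue_space R n.+1) (X `*` Y) =
  (lebesgue_measure X * sf_meas (lebesgue_space R n) Y)%E.
Proof. by move=> mX mY; exact: product_measure1E. Qed.

(** A product measure is determined by its values on rectangles, where each of the [n] factors
    contributes one [a] by the one-dimensional case. *)
Lemma sf_meas_affine a n (b : 'rV[R]_n) (A : set (sf_car (lebesgue_space R n))) :
  0 < a -> measurable A ->
  ((a ^+ n)%:E * sf_meas (lebesgue_space R n) (aff_space a b @^-1` A) =
   sf_meas (lebesgue_space R n) A)%E.
Proof.
move=> a0; elim: n b A => [|n IH] b A mA.
  by rewrite expr0 mul1e.
have an : 0 <= a ^+ n.+1 by apply: exprn_ge0; exact: ltW.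
set L := lebesgue_space R n.+1.
pose nu : measure (sf_car L) R :=
  mscale (NngNum an) (pushforward (sf_meas L) (aff_space a b)).
pose mu' := nu (@aff_space_measurable a _ b).
suff E X Y : measurable X -> measurable Y ->
    mu' (X `*` Y) = (lebesgue_measure X * sf_meas (lebesgue_space R n) Y)%E.
  exact/esym/(product_measure_unique E mA).
move=> mX mY.
change (mu' (X `*` Y)) with
  ((a ^+ n.+1)%:E * sf_meas L (aff_space a b @^-1` (X `*` Y)))%E.
have -> : aff_space a b @^-1` (X `*` Y) =
  ((fun x => a * x + b 0 0) @^-1` X) `*`
  (aff_space a (\row_j b 0 (lift 0 j)) @^-1` Y) by [].
rewrite sf_measX; last 2 first.
- by rewrite -[X in measurable X]setTI; exact: affR_meas.
- by rewrite -[X in measurable X]setTI; exact: aff_space_measurable.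
rewrite -(lebesgue_measure_affine (b 0 0) a0 mX).
rewrite -(IH (\row_j b 0 (lift 0 j)) _ mY).
by rewrite exprS EFinM muleACA.
Qed.
End Volume.

(** * Monotonicity, additivity and scaling of volume *)

Section Measurability.
Variables (R : realType) (n : nat).
Implicit Types (A B S : set 'rV[R]_n) (u v x y : 'rV[R]_n).

(** Measurability of the very preimage that [Vol] measures. *)
Definition vmeasurable A := measurable (@row_of R n @^-1` A).

Lemma Vol_affine (a : R) (b : 'rV[R]_n) A : 0 < a -> vmeasurable A ->
  ((a ^+ n)%:E * Vol [set x | A (a *: x + b)%R] = Vol A)%E.
Proof.
move=> a0 mA; apply: etrans (sf_meas_affine b a0 mA).
rewrite /Vol; congr (_ * sf_meas _ _)%E.
by apply/seteqP; split => x /=; rewrite row_of_aff_space.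
Qed.

Lemma vmeasurable_affine (a : R) (b : 'rV[R]_n) A : vmeasurable A ->
  vmeasurable [set x | A (a *: x + b)].
Proof.
move=> mA; rewrite /vmeasurable.
have -> : @row_of R n @^-1` [set x | A (a *: x + b)] =
    aff_space a b @^-1` (@row_of R n @^-1` A).
  by apply/seteqP; split => x /=; rewrite row_of_aff_space.
by rewrite -[X in measurable X]setTI; exact: aff_space_measurable.
Qed.

Lemma le_Vol A B : vmeasurable A -> vmeasurable B -> A `<=` B ->
  (Vol A <= Vol B)%E.
Proof.
move=> mA mB AB; apply: le_measure; rewrite ?inE// => x; exact: AB.
Qed.

Lemma Vol_disjoint A B S : vmeasurable A -> vmeasurable B -> vmeasurable S ->
  A `<=` S -> B `<=` S -> (forall x, A x -> B x -> False) ->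
  (Vol A + Vol B <= Vol S)%E.
Proof.
move=> mA mB mS AS BS AB; rewrite /Vol -measureU//; last first.
  by rewrite -subset0 => x [/AB].
apply: le_measure; rewrite ?inE//; first exact: measurableU.
by move=> x [/AS|/BS].
Qed.

Lemma Vol_cover A B S : vmeasurable A -> vmeasurable B -> vmeasurable S ->
  S `<=` A `|` B -> (Vol S <= Vol A + Vol B)%E.
Proof.
move=> mA mB mS SAB; apply: le_trans (measureU2 _ mA mB).
by apply: le_measure; rewrite ?inE//; [exact: measurableU|move=> x /SAB].
Qed.

Lemma vmeasurable_bigcap (I : finType) (F : I -> set 'rV[R]_n) :
  (forall i, vmeasurable (F i)) -> vmeasurable [set x | forall i, F i x].
Proof.
move=> mF.
have -> : [set x | forall i, F i x] = \bigcap_(i in setT) F i.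
  by apply/seteqP; split => x /=; [move=> h i _|move=> h i; apply: h].
rewrite /vmeasurable preimage_bigcap.
by apply: fin_bigcap_measurable => [|i _]; [exact: finite_finset|exact: mF].
Qed.
End Measurability.

Lemma row_of_coord_measurable (R : realType) n (i : 'I_n) :
  measurable_fun setT (fun x : sf_car (lebesgue_space R n) => row_of x 0 i).
Proof.
elim: n i => [|n IH] i; first by case: i.
case: (unliftP 0 i) => [j|] ->.
  rewrite (_ : (fun _ => _) =
    (fun x => row_of x 0 j) \o (snd : sf_car (lebesgue_space R n.+1) -> _)).
    exact: measurableT_comp (IH j) measurable_snd.
  by apply/funext => x; rewrite row_of_lift.
rewrite (_ : (fun _ => _) = (fst : sf_car (lebesgue_space R n.+1) -> _)).
  exact: measurable_fst.
by apply/funext => x; rewrite row_of_ord0.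
Qed.

(** * Measurability of cuts, knowledge sets and thickened sets *)

Section Sets.
Variables (R : realType) (n : nat).
Implicit Types (A B S : set 'rV[R]_n) (u v x y : 'rV[R]_n).

Lemma vmeasurable_coord (i : 'I_n) (I : interval R) :
  vmeasurable [set x : 'rV[R]_n | x 0 i \in I].
Proof.
rewrite /vmeasurable -[X in measurable X]setTI.
exact: (row_of_coord_measurable i measurableT (measurable_itv I)).
Qed.

Lemma vmeasurable_dotv u (I : interval R) :
  vmeasurable [set x : 'rV[R]_n | dotv u x \in I].
Proof.
rewrite /vmeasurable -[X in measurable X]setTI.
have mf : measurable_fun setT
    (fun x : sf_car (lebesgue_space R n) => dotv u (row_of x)).
  apply: measurable_sum => i.
  by apply: measurable_funM => //; exact: row_of_coord_measurable.
exact: (mf measurableT _ (measurable_itv I)).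
Qed.

Lemma vmeasurable_setI A B : vmeasurable A -> vmeasurable B ->
  vmeasurable (A `&` B).
Proof. exact: measurableI. Qed.

Lemma vmeasurable_cut_ge S p u : vmeasurable S -> vmeasurable (cut_ge S p u).
Proof.
move=> mS; have := vmeasurable_setI mS (vmeasurable_dotv u `[p, +oo[).
by congr vmeasurable; apply/seteqP; split => x /=; rewrite in_itv/= andbT.
Qed.

Lemma vmeasurable_cut_le S p u : vmeasurable S -> vmeasurable (cut_le S p u).
Proof.
move=> mS; have := vmeasurable_setI mS (vmeasurable_dotv u `]-oo, p]).
by congr vmeasurable; apply/seteqP; split => x /=; rewrite in_itv.
Qed.

Lemma vmeasurable_knowledge v us ps t :
  vmeasurable (knowledge v us ps t : set 'rV[R]_n).
Proof.
elim: t => [|t IH] /=; last first.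
  by case: ifP => _; [exact: vmeasurable_cut_ge|exact: vmeasurable_cut_le].
have := vmeasurable_bigcap (fun i => vmeasurable_coord i `[0, 1]).
by congr vmeasurable; apply/seteqP; split => x /= h i; have := h i; rewrite in_itv.
Qed.

Definition open_box x (r : R) : set 'rV[R]_n :=
  [set y | forall i, `|y 0 i - x 0 i| < r].

(** The Minkowski sum of [S] and an open sup-norm box centred at 0. It is open, hence measurable,
    whatever [S] is. *)
Definition thicken S (r : R) : set 'rV[R]_n :=
  [set y | exists2 x, S x & open_box x r y].

Lemma vmeasurable_open_box x r : vmeasurable (open_box x r).
Proof.
have := vmeasurable_bigcap
  (fun i => vmeasurable_coord i `]x 0 i - r, x 0 i + r[).
congr vmeasurable; apply/seteqP; split => y /= h i; have := h i;
by rewrite in_itv/= ltr_distl.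
Qed.

(* An open set is the union of the countably many rational boxes it contains. *)
Lemma vmeasurable_thicken S r : vmeasurable (thicken S r).
Proof.
pose Q := {ffun 'I_n -> (rat * rat)%type}.
pose box (q : Q) : set 'rV[R]_n :=
  [set y | forall i, y 0 i \in `](ratr (q i).1 : R), ratr (q i).2[].
pose F (q : Q) := if `[< box q `<=` thicken S r >] then box q else set0.
have -> : thicken S r = \bigcup_q F q.
  apply/seteqP; split => [y [x Sx xy]|y [q _]]; last first.
    by rewrite /F; case: asboolP => // h /h.
  have lt i : exists q : rat * rat, [/\ x 0 i - r < ratr q.1, 
      (ratr q.1 : R) < y 0 i, y 0 i < ratr q.2 & ratr q.2 < x 0 i + r].
    have := xy i; rewrite ltr_distl => /andP[/rat_in_itvoo[q1 h1]].
    move=> /rat_in_itvoo[q2 h2]; exists (q1, q2) => /=.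
    by move: h1 h2; rewrite !in_itv/= => /andP[-> ->] /andP[-> ->].
  have [q hq] := choice lt.
  exists [ffun i => q i] => //; rewrite /F asboolT; last first.
    move=> z hz; exists x => // i; have := hz i.
    rewrite ffunE in_itv/= ltr_distl => /andP[h1 h2].
    have [h3 _ _ h4] := hq i.
    by rewrite (lt_trans h3 h1) (lt_trans h2 h4).
  by move=> i; rewrite ffunE in_itv/=; have [_ -> ->] := hq i.
rewrite /vmeasurable preimage_bigcup.
apply: countable_bigcupT_measurable; first exact: countableP.
move=> q; rewrite /F; case: asboolP => _.
  exact: vmeasurable_bigcap (fun i => vmeasurable_coord i _).
by rewrite preimage_set0.
Qed.
End Sets.

(** This box is the unit of volume: both bounds on the potential are multiples of its volume, which
    then cancels. *)
Lemma Vol_unit_box (R : realType) n :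
  (0 < Vol (open_box (0 : 'rV[R]_n) 1) < +oo)%E.
Proof.
elim: n => [|n].
  rewrite /Vol (_ : _ @^-1` _ = setT) /=.
    by rewrite diracT lte01 ltry.
  by apply/seteqP; split => // x _ [].
rewrite /Vol; set A := _ @^-1` _; move=> /andP[A0 Aoo].
set A' := _ @^-1` _.
have -> : A' = [set` `]-1, 1[] `*` A.
  apply/seteqP; split => -[x1 x2] /=.
    move=> h; split.
      by have := h 0; rewrite row_of_ord0 mxE ltr_distl in_itv/= !add0r.
    by move=> i; have := h (lift 0 i); rewrite row_of_lift !mxE.
  move=> [h1 h2] i; case: (unliftP 0 i) => [j|] ->.
    by have := h2 j; rewrite row_of_lift !mxE.
  by rewrite row_of_ord0 mxE ltr_distl; move: h1; rewrite in_itv/= !add0r.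
rewrite sf_measX; last 2 first.
- exact: measurable_itv.
- exact: vmeasurable_open_box.
rewrite lebesgue_measure_itv/= lte_fin ifT; last by lra.
rewrite -EFinD opprK; apply/andP; split.
  by apply: mule_gt0 => //; rewrite lte_fin; lra.
by apply: lte_mul_pinfty => //; rewrite lee_fin; lra.
Qed.

(** * Homotheties, and the volume lost in one halving cut *)

Section Homothety.
Variables (R : realType) (n : nat).
Implicit Types (A S : set 'rV[R]_n) (c u x y z : 'rV[R]_n).

(** For [l > 0], the image of [A] under [z => c + l (z - c)], written as a preimage under the
    inverse map so that the affine lemmas apply. *)
Definition homothety c (l : R) A : set 'rV[R]_n :=
  [set x | A (l^-1 *: x + (c - l^-1 *: c))].

Lemma vmeasurable_homothety c l A : vmeasurable A -> vmeasurable (homothety c l A).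
Proof. exact: vmeasurable_affine. Qed.

Lemma Vol_homothety c l A : 0 < l -> vmeasurable A ->
  Vol (homothety c l A) = ((l ^+ n)%:E * Vol A)%E.
Proof.
move=> l0 mA; have il0 : 0 < l^-1 by rewrite invr_gt0.
rewrite -(Vol_affine (c - l^-1 *: c) il0 mA) muleA -EFinM -exprMn divff ?gt_eqF//.
by rewrite expr1n mul1e.
Qed.

Lemma homothetyP c l A x : 0 < l -> homothety c l A x ->
  exists2 z, A z & x = (1 - l) *: c + l *: z.
Proof.
move=> l0 Ax; exists (l^-1 *: x + (c - l^-1 *: c)) => //.
apply/rowP => i; rewrite !mxE; field.
by rewrite gt_eqF.
Qed.

Lemma Vol_open_box x r : 0 < r ->
  Vol (open_box x r) = ((r ^+ n)%:E * Vol (open_box (0 : 'rV[R]_n) 1%R))%E.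
Proof.
move=> r0; rewrite -(Vol_affine (- (r^-1 *: x)) (A := open_box 0 1)
  (a := r^-1)) ?invr_gt0//; last exact: vmeasurable_open_box.
rewrite muleA -EFinM -exprMn divff ?gt_eqF// expr1n mul1e; congr Vol.
apply/seteqP; split => y /= h i; have := h i; rewrite !mxE subr0 -mulrBr normrM
  gtr0_norm ?invr_gt0// mulrC ltr_pdivrMr ?mul1r//.
Qed.

Lemma dotvD u x y : dotv u (x + y) = dotv u x + dotv u y.
Proof. by rewrite /dotv -big_split; apply: eq_bigr => i _; rewrite mxE mulrDr. Qed.

Lemma dotvZ u l x : dotv u (l *: x) = l * dotv u x.
Proof. by rewrite /dotv mulr_sumr; apply: eq_bigr => i _; rewrite mxE mulrCA. Qed.

Lemma dotvNl u x : dotv (- u) x = - dotv u x.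
Proof. by rewrite /dotv -sumrN; apply: eq_bigr => i _; rewrite mxE mulNr. Qed.

Lemma dotv_bound u x r : (forall i, `|u 0 i| <= 1) -> (forall i, `|x 0 i| <= r) ->
  `|dotv u x| <= n%:R * r.
Proof.
move=> hu hx; apply: le_trans (ler_norm_sum _ _ _) _.
apply: (@le_trans _ _ (\sum_(i < n) r)).
  apply: ler_sum => i _; rewrite normrM.
  by rewrite (le_trans _ (hx i))// ler_piMl.
by rewrite sumr_const card_ord mulr_natl.
Qed.

Lemma enorm1_coord u i : enorm u = 1 -> `|u 0 i| <= 1.
Proof.
move=> u1; have : dotv u u <= 1.
  rewrite -(@ler_sqrt _ _ 1)// sqrtr1.
  by move: u1; rewrite /enorm => ->.
rewrite /dotv (bigD1 i)//= => h.
have : u 0 i ^+ 2 <= 1.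
  rewrite expr2; apply: le_trans h; rewrite lerDl.
  by apply: sumr_ge0 => j _; rewrite -expr2 sqr_ge0.
by rewrite -real_normK ?num_real// -[X in _ <= X -> _](expr1n _ 2) ler_pXn2r ?nnegrE.
Qed.

Lemma cut_leE S p u : cut_le S p u = cut_ge S (- p) (- u).
Proof. by apply/seteqP; split => x [Sx] /= h; split => //; move: h; rewrite dotvNl lerN2. Qed.

Lemma cut_geE S p u : cut_ge S p u = cut_le S (- p) (- u).
Proof. by rewrite cut_leE !opprK. Qed.

(** Convexity, with the weights that [homothetyP] produces. *)
Definition segment_closed S := forall x y (l : R),
  S x -> S y -> 0 <= l <= 1 -> S ((1 - l) *: x + l *: y).

Lemma bernoulli_sub (a : R) k : 0 <= a <= 1 -> 1 - k%:R * a <= (1 - a) ^+ k.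
Proof.
move=> /andP[a0 a1]; elim: k => [|k IH]; first by rewrite mul0r subr0.
rewrite exprS; have h : (1 - a) * (1 - k%:R * a) <= (1 - a) * (1 - a) ^+ k.
  by apply: ler_wpM2l => //; rewrite subr_ge0.
apply: le_trans h; rewrite -natr1.
have : 0 <= k%:R * a ^+ 2 by rewrite mulr_ge0// sqr_ge0.
by rewrite expr2; lra.
Qed.

(* Otherwise the homothety of ratio [1 - 1 / (4n)] centred at [x] maps [S] into
   [S] strictly above the cut, so less than half of the volume lies below. *)
Lemma halving_depth S u p x : (0 < n)%N -> segment_closed S -> vmeasurable S ->
  (0 < Vol S < +oo)%E -> Vol (cut_ge S p u) = Vol (cut_le S p u) ->
  S x -> p < dotv u x ->
  exists2 y, S y & dotv u y < p - (dotv u x - p) / (4 * n%:R).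
Proof.
move=> n0 cS mS /andP[S0 Soo] eqV Sx px.
apply: contrapT => /forall2NP h.
have {}h y : S y -> p - (dotv u x - p) / (4 * n%:R) <= dotv u y.
  by move=> Sy; have [//|/negP] := h y; rewrite -leNgt.
have nR : 1 <= n%:R :> R by rewrite ler1n.
(* Since [n * a = 1 / 4], Bernoulli's inequality keeps [(1 - a) ^+ n] at least 3/4, which exceeds
   the 1/2 that would be consistent with halving. *)
set a : R := (4 * n%:R)^-1.
have a0 : 0 < a by rewrite invr_gt0; lra.
have na : n%:R * a = 1 / 4 by rewrite /a; field; rewrite pnatr_eq0 -lt0n.
have a1 : a <= 1 / 4 by rewrite -na ler_peMl// ltW.
have l0 : 0 < 1 - a by lra.
pose A := homothety x (1 - a) S.
have mA : vmeasurable A by exact: vmeasurable_homothety.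
have mC : vmeasurable (cut_le S p u) by exact: vmeasurable_cut_le.
have mG : vmeasurable (cut_ge S p u) by exact: vmeasurable_cut_ge.
have h1 : (Vol A + Vol (cut_le S p u) <= Vol S)%E.
  apply: Vol_disjoint => //.
  - by move=> z /(homothetyP l0)[w Sw ->]; apply: cS => //; apply/andP; split; lra.
  - by move=> z [].
  - move=> z /(homothetyP l0)[w Sw ->] [_].
    rewrite dotvD !dotvZ => hw.
    (* With [H = dotv u x - p], the image of [w] has height at least [p + a^2 H], hence lies
       strictly above the cut. *)
    have : 0 <= (1 - a) * (dotv u w - (p - (dotv u x - p) * a)).
      by rewrite mulr_ge0 ?subr_ge0//; [lra|exact: h].
    have : 0 < a * a * (dotv u x - p) by rewrite !mulr_gt0// subr_gt0.
    by lra.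
have h2 : (Vol S <= Vol (cut_ge S p u) + Vol (cut_le S p u))%E.
  apply: Vol_cover => // z Sz; have [?|?] := leP p (dotv u z); first by left.
  by right; split => //; exact: ltW.
have h3 := bernoulli_sub n (_ : 0 <= a <= 1).
move: h1 h2; rewrite eqV Vol_homothety//.
have : (Vol (cut_le S p u) <= Vol S)%E by apply: le_Vol => // z [].
have : (0 <= Vol (cut_le S p u))%E by exact: measure_ge0.
(* With [s] the volume of [S] and [c] that of each side, [3/4 s + c <= s] and [s <= 2 c] contradict
   [s > 0]. *)
move: S0 Soo; case: (Vol S) => // s; case: (Vol _) => // c.
rewrite -EFinM -!EFinD !lee_fin !lte_fin => s0 _ c0 cs h1 h2.
have {}h3 : 3 / 4 <= (1 - a) ^+ n.
  by apply: le_trans (h3 _); rewrite ?na; lra.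
have := ler_wpM2r (ltW s0) h3; lra.
Qed.

Lemma thicken_sub S S' r : S `<=` S' -> thicken S r `<=` thicken S' r.
Proof. by move=> h z [x /h Sx xz]; exists x. Qed.

Lemma dotv_open_box u x y r : (forall i, `|u 0 i| <= 1) -> open_box x r y ->
  `|dotv u y - dotv u x| <= n%:R * r.
Proof.
move=> hu xy; have -> : dotv u y - dotv u x = dotv u (y - x).
  by rewrite -(scaleN1r x) dotvD dotvZ mulN1r.
by apply: dotv_bound => // i; rewrite !mxE ltW.
Qed.

(* [y] below is a point whose depth under the cut exceeds [D / (8n)], where [D]
   is the maximal height of [S] above the cut; the homothety of ratio [1 / (16n)]
   centred at [y] sends [thicken S r] to heights below [p - n r], which
   [thicken (cut_ge S p u) r] does not reach. *)
Lemma thicken_cut_ge S u p x (r : R) : (0 < n)%N -> segment_closed S ->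
  vmeasurable S -> (0 < Vol S < +oo)%E ->
  Vol (cut_ge S p u) = Vol (cut_le S p u) ->
  (forall i, `|u 0 i| <= 1) -> has_ubound [set dotv u x | x in S] ->
  S x -> 0 < r -> 32 * n%:R ^+ 2 * r <= dotv u x - p ->
  (Vol (thicken (cut_ge S p u) r) +
   (((16 * n%:R)^-1 ^+ n)%R)%:E * Vol (thicken S r) <= Vol (thicken S r))%E.
Proof.
move=> n0 cS mS fS eqV hu ubS Sx r0 hr.
have nR : 1 <= n%:R :> R by rewrite ler1n.
set E := [set dotv u x | x in S].
have supE : has_sup E by split => //; exists (dotv u x), x.
pose D := sup E - p.
have DE z : S z -> dotv u z <= D + p.
  by move=> Sz; rewrite /D subrK; apply: ub_le_sup => //; exists z.
have Dr : 32 * n%:R ^+ 2 * r <= D by apply: le_trans hr _; have := DE x Sx; lra.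
have D0 : 0 < D by apply: lt_le_trans Dr; rewrite !mulr_gt0//; lra.
have D20 : 0 < D / 2 by lra.
(* A point higher than [D / 2] replaces a maximiser, which need not exist; this turns the depth
   [D / (4n)] into [D / (8n)]. *)
have [_ [x1 Sx1 <-] hx1] := sup_adherent D20 supE.
have {}hx1 : D / 2 < dotv u x1 - p by move: hx1; rewrite /D; lra.
have px1 : p < dotv u x1 by lra.
have [y Sy hy] := halving_depth n0 cS mS fS eqV Sx1 px1.
set m : R := (16 * n%:R)^-1.
(* In units of [q], the depth of [y] exceeds 1/8, [n r] is at most 1/32 and [m D] is 1/16. *)
pose q := D / n%:R.
have DQ : D = q * n%:R by rewrite /q divfK// pnatr_eq0 -lt0n.
have q0 : 0 < q by rewrite divr_gt0//; lra.
have {}hy : dotv u y - p < - (q / 8).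
  apply: lt_le_trans (_ : - ((dotv u x1 - p) / (4 * n%:R)) <= _); first by lra.
  rewrite lerN2 ler_pdivlMr; last by lra.
  by lra.
have nr : n%:R * r <= q / 32.
  rewrite /q -mulrA -invfM ler_pdivlMr; last by lra.
  by apply: le_trans Dr; rewrite expr2; lra.
have m0 : 0 < m by rewrite invr_gt0; lra.
have mD : m * D = q / 16 by rewrite DQ /m; field; rewrite pnatr_eq0 -lt0n.
have m1 : m <= 1 / 16.
  by rewrite /m invfM mul1r ler_piMr// invf_le1; lra.
rewrite -(Vol_homothety y)//; last exact: vmeasurable_thicken.
apply: Vol_disjoint.
- exact/vmeasurable_thicken.
- exact/vmeasurable_homothety/vmeasurable_thicken.
- exact/vmeasurable_thicken.
- by apply: thicken_sub => z [].
(* The homothety sends [s] to a point of [S] by convexity, and shrinks the box around [s]. *)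
- move=> z /(homothetyP m0)[w [s Ss sw] ->].
  exists ((1 - m) *: y + m *: s); first by apply: cS => //; apply/andP; split; lra.
  move=> i; rewrite !mxE opprD addrACA subrr add0r -mulrBr normrM gtr0_norm//.
  apply: le_lt_trans (sw i).
  by rewrite ler_piMl//; lra.
- move=> z [s [Ss ps] sz] /(homothetyP m0)[w [s' Ss' sw] zE].
  have /ler_normlP[h1 _] := dotv_open_box hu sz.
  have /ler_normlP[_ h2] := dotv_open_box hu sw.
  have h3 := DE _ Ss'; have : dotv u z = (1 - m) * dotv u y + m * dotv u w.
    by rewrite zE dotvD !dotvZ.
  (* Relative to [p], the height of [z] is at least [- q / 32] by [h1], but less than
     [- (1 - m) q / 8 + m (D + q / 32)], which is below [- q / 32] because [m <= 1 / 16]. *)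
  have h4 : dotv u w - p <= D + q / 32 by lra.
  have h5 : m * (dotv u w - p) <= m * D + m * (q / 32).
    by rewrite -mulrDr; apply: ler_wpM2l => //; exact: ltW.
  nra.
Qed.
End Homothety.

(** * Geometry of the knowledge sets, and the potential drop in one round *)

Section Knowledge.
Variables (R : realType) (n : nat) (v : 'rV[R]_n) (us : nat -> 'rV[R]_n)
  (ps : nat -> R).
Local Notation K := (knowledge v us ps).

Lemma segment_closed_cut_ge (S : set 'rV[R]_n) p u :
  segment_closed S -> segment_closed (cut_ge S p u).
Proof.
move=> cS x y l [Sx px] [Sy py] hl; split; first exact: cS.
by rewrite dotvD !dotvZ; case/andP: hl => l0 l1; nra.
Qed.

Lemma segment_closed_knowledge t : segment_closed (K t).
Proof.
elim: t => [|t IH] /=; last first.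
  by case: ifP => _; [|rewrite cut_leE]; exact: segment_closed_cut_ge.
move=> x y l hx hy hl i; rewrite !mxE; have := hx i; have := hy i.
move=> /andP[? ?] /andP[? ?]; case/andP: hl => l0 l1.
by apply/andP; split; nra.
Qed.

Lemma knowledge_cube t : K t `<=` @unit_cube R n.
Proof.
elim: t => [//|t IH] /= x; case: ifP => _ [Sx _]; exact: IH.
Qed.

Lemma mem_knowledge t : @unit_cube R n v -> K t v.
Proof.
move=> hv; elim: t => [//|t IH] /=; case: ifP => [h|/negbT]; first by split.
by rewrite -ltNge => /ltW h; split.
Qed.

Lemma cube_coord (x : 'rV[R]_n) : unit_cube x -> forall i, `|x 0 i| <= 1.
Proof. by move=> hx i; have /andP[x0 x1] := hx i; rewrite ger0_norm. Qed.

Lemma knowledge_ubound t (u : 'rV[R]_n) : (forall i, `|u 0 i| <= 1) ->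
  has_ubound [set dotv u x | x in K t].
Proof.
move=> hu; exists n%:R => _ [x /knowledge_cube hx <-].
apply: le_trans (ler_norm _) _.
by have := dotv_bound hu (cube_coord hx); rewrite mulr1.
Qed.

Lemma Vol_knowledge0 : (0 < Vol (K 0) < +oo)%E.
Proof.
have /andP[V0 Voo] := Vol_unit_box R n.
have m0 := vmeasurable_knowledge v us ps 0.
apply/andP; split.
  pose c : 'rV[R]_n := const_mx (1 / 2); pose h2 : R := 1 / 2.
  have h : (0 < Vol (open_box c h2))%E.
    rewrite Vol_open_box /h2; last by lra.
    by apply: mule_gt0 => //; rewrite lte_fin exprn_gt0//; lra.
  apply: lt_le_trans h _; apply: le_Vol => //; first exact: vmeasurable_open_box.
  move=> x hx i; have := hx i; rewrite mxE ltr_distl /h2 => /andP[? ?].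
  by apply/andP; split; lra.
have h : (Vol (K 0) <= Vol (open_box (0%R : 'rV[R]_n) 2%R))%E.
  apply: le_Vol => //; first exact: vmeasurable_open_box.
  by move=> x /cube_coord hx i; rewrite mxE subr0; have := hx i; lra.
apply: le_lt_trans h _; rewrite Vol_open_box//; exact: lte_mul_pinfty.
Qed.

Variable T : nat.
Hypothesis halving : forall t, (t < T)%N ->
  Vol (cut_ge (K t) (ps t) (us t)) = Vol (cut_le (K t) (ps t) (us t)).

(** The two sides of a cut cover [K t] and have equal volume, so neither is null. *)
Lemma Vol_knowledge t : (t <= T)%N -> (0 < Vol (K t) < +oo)%E.
Proof.
elim: t => [_|t IH tT]; first exact: Vol_knowledge0.
have /andP[V0 Voo] := IH (ltnW tT).
have mS := vmeasurable_knowledge v us ps t.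
have mG := vmeasurable_cut_ge (ps t) (us t) mS.
have mL := vmeasurable_cut_le (ps t) (us t) mS.
have h : (Vol (K t) <= Vol (cut_ge (K t) (ps t) (us t)) +
                       Vol (cut_le (K t) (ps t) (us t)))%E.
  apply: Vol_cover => // x Sx.
  have [?|/ltW ?] := leP (ps t) (dotv (us t) x); first by left.
  by right.
have -> : Vol (K t.+1) = Vol (cut_ge (K t) (ps t) (us t)).
  by rewrite /=; case: ifP => // _; rewrite -halving.
apply/andP; split; last first.
  by apply: le_lt_trans Voo; apply: le_Vol => // x [].
rewrite lt_neqAle measure_ge0 andbT; apply/eqP => h0.
by move: h; rewrite -halving// -h0 adde0 leNgt V0.
Qed.

Hypothesis v_cube : @unit_cube R n v.
Hypothesis n_gt0 : (0 < n)%N.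
Hypothesis us_coord : forall t, (t < T)%N -> forall i, `|us t 0 i| <= 1.

(** Both sides of the cut are nonempty, so [ps t] lies between two values of [dotv (us t)] on the
    cube, all of absolute value at most [n]. *)
Lemma knowledge_loss_le t : (t < T)%N ->
  `|dotv (us t) v - ps t| <= 2 * n%:R.
Proof.
move=> tT; have ht := us_coord tT.
have B x : K t x -> `|dotv (us t) x| <= n%:R.
  move=> /knowledge_cube hx.
  by have := dotv_bound ht (cube_coord hx); rewrite mulr1.
have /andP[V0 _] := Vol_knowledge tT.
have Vne (A : set 'rV[R]_n) : (0 < Vol A)%E -> exists x, A x.
  by move=> A0; apply/set0P/eqP => A00; move: A0; rewrite A00 /Vol preimage_set0
    measure0 ltxx.
have eqV : Vol (K t.+1) = Vol (cut_ge (K t) (ps t) (us t)).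
  by rewrite /=; case: ifP => // _; rewrite -halving.
have [x [Sx px]] : exists x, cut_ge (K t) (ps t) (us t) x.
  by apply: Vne; rewrite -eqV.
have [y [Sy py]] : exists x, cut_le (K t) (ps t) (us t) x.
  by apply: Vne; rewrite -halving// -eqV.
have := B _ Sx; have := B _ Sy; have := B _ (mem_knowledge t v_cube).
by rewrite !ler_norml => /andP[? ?] /andP[? ?] /andP[? ?]; apply/andP; split; lra.
Qed.

(** As [v] is never cut away, the loss is the height of a point of the kept side over the cut, as
    [thicken_cut_ge] requires. *)
Lemma thicken_knowledge t (r : R) : (t < T)%N -> 0 < r ->
  32 * n%:R ^+ 2 * r <= `|dotv (us t) v - ps t| ->
  (Vol (thicken (K t.+1) r) +
   (((16 * n%:R)^-1 ^+ n)%R)%:E * Vol (thicken (K t) r) <= Vol (thicken (K t) r))%E.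
Proof.
move=> tT r0 hr.
have cS := @segment_closed_knowledge t.
have mS := vmeasurable_knowledge v us ps t.
have fS := Vol_knowledge (ltnW tT).
have Sv := mem_knowledge t v_cube.
rewrite /=; case: ifP => [h|/negbT].
  apply: (thicken_cut_ge (x := v)) => //; first exact: halving.
  - exact: us_coord.
  - exact/knowledge_ubound/us_coord.
  - by move: hr; rewrite ger0_norm ?subr_ge0.
rewrite -ltNge => h.
(* Negating both [us t] and [ps t] turns the lower side into an upper one. *)
rewrite cut_leE; apply: (thicken_cut_ge (x := v)) => //.
- by rewrite -cut_leE -cut_geE halving.
- by move=> i; rewrite mxE normrN; exact: us_coord.
- by apply: knowledge_ubound => i; rewrite mxE normrN; exact: us_coord.
- by move: hr; rewrite ltr0_norm ?subr_lt0// dotvNl opprK opprB addrC.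
Qed.

Lemma knowledge_subS t : K t.+1 `<=` K t.
Proof. by move=> x /=; case: ifP => _ []. Qed.
End Knowledge.

(** * Geometric decay and dyadic sums of reals *)

Section Counting.
Variable R : realType.

Lemma geometric_decay (phi : nat -> R) (b : nat -> bool) (e : R) T :
  0 <= e <= 1 -> (forall t, (t < T)%N -> phi t.+1 <= phi t) ->
  (forall t, (t < T)%N -> b t -> phi t.+1 <= (1 - e) * phi t) ->
  phi T <= (1 - e) ^+ (\sum_(t < T) b t) * phi 0.
Proof.
move=> /andP[e0 e1]; elim: T => [|T IH] h1 h2.
  by rewrite big_ord0 expr0 mul1r.
have {}IH := IH (fun t tT => h1 t (ltnW tT)) (fun t tT => h2 t (ltnW tT)).
rewrite big_ord_recr /=; have := h2 T (leqnn _); case: (b T) => h3; last first.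
  by rewrite addn0; exact: le_trans (h1 _ _) IH.
rewrite addn1 exprS -mulrA; apply: le_trans (h3 isT) _.
by apply: ler_wpM2l => //; lra.
Qed.

(** With [e = 1 / k], Bernoulli gives [(1 + e) ^+ k >= 2], while [(1 - e) (1 + e) <= 1]. *)
Lemma half_decay (k : nat) : (0 < k)%N -> (1 - k%:R^-1) ^+ k <= 1 / 2 :> R.
Proof.
move=> k0; set e : R := k%:R^-1.
have kR : 1 <= k%:R :> R by rewrite ler1n.
have e0 : 0 < e by rewrite invr_gt0; lra.
have e1 : e <= 1 by rewrite /e invf_le1//; lra.
have ke : k%:R * e = 1 by rewrite /e divff// pnatr_eq0 -lt0n.
have h1 : 2 <= (1 + e) ^+ k.
  suff : forall j, 1 + j%:R * e <= (1 + e) ^+ j by move=> /(_ k); rewrite ke; lra.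
  elim=> [|j IH]; first by rewrite mul0r addr0.
  rewrite exprS -natr1; have : (1 + e) * (1 + j%:R * e) <= (1 + e) * (1 + e) ^+ j.
    by apply: ler_wpM2l => //; lra.
  have : 0 <= e * (j%:R * e) by rewrite !mulr_ge0// ltW.
  lra.
have h2 : (1 - e) ^+ k * (1 + e) ^+ k <= 1.
  rewrite -exprMn; apply: exprn_ile1; nra.
have h3 : 0 <= (1 - e) ^+ k by apply: exprn_ge0; lra.
nra.
Qed.

(** If layer [i] is the largest one not above [x], then [x] is at most twice that layer, which is
    the sum of the layers [i] to [m] plus [e0 / 2 ^+ m]. If there is none, [x < e0 / 2 ^+ m]. *)
Lemma dyadic_layers (x e0 : R) m : 0 <= e0 -> 0 <= x <= 2 * e0 ->
  x <= e0 / 2 ^+ m + \sum_(j < m.+1) e0 / 2 ^+ j * (e0 / 2 ^+ j <= x)%R%:R.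
Proof.
move=> he /andP[x0 x1].
have ge0 k : 0 <= \sum_(j < k) e0 / 2 ^+ j * (e0 / 2 ^+ j <= x)%R%:R.
  by apply: sumr_ge0 => j _; rewrite !mulr_ge0// invr_ge0 exprn_ge0.
elim: m => [|m IH].
  rewrite big_ord1 expr0 divr1; by case: (leP e0 x) => h /=; lra.
rewrite big_ord_recr /=; set e := e0 / 2 ^+ m.+1.
have ee : e0 / 2 ^+ m = 2 * e by rewrite /e exprS; field; rewrite expf_neq0.
have := ge0 m.+1; move: IH; rewrite ee.
by case: (leP e x) => h /=; lra.
Qed.

Lemma sum_linear_dyadic (a : R) m : 0 <= a ->
  \sum_(j < m) (j%:R + a) / 2 ^+ j <= 2 * (a + 1).
Proof.
(* The exact partial sum is what the induction can carry. *)
move=> a0; suff : \sum_(j < m) (j%:R + a) / 2 ^+ j =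
    2 * (a + 1) - 2 * (m%:R + a + 1) / 2 ^+ m.
  move=> ->; rewrite gerBl divr_ge0 ?exprn_ge0//.
  have : 0 <= m%:R :> R by []. 
  lra.
elim: m => [|m IH]; first by rewrite big_ord0 expr0 invr1; lra.
rewrite big_ord_recr /= IH exprS -natr1; field.
by rewrite expf_neq0.
Qed.
End Counting.

(** * Number of rounds at each loss scale, and the total loss *)

Section TotalLoss.
Variables (R : realType) (n : nat) (v : 'rV[R]_n) (us : nat -> 'rV[R]_n)
  (ps : nat -> R) (T : nat).
Local Notation K := (knowledge v us ps).
Local Notation loss t := (`|dotv (us t) v - ps t|).
Hypothesis halving : forall t, (t < T)%N ->
  Vol (cut_ge (K t) (ps t) (us t)) = Vol (cut_le (K t) (ps t) (us t)).
Hypothesis v_cube : @unit_cube R n v.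
Hypothesis n_gt0 : (0 < n)%N.
Hypothesis us_coord : forall t, (t < T)%N -> forall i, `|us t 0 i| <= 1.

(** A round of large loss removes at least the fraction [1 / C] of the potential; [C] is a natural
    number so that it can also be an exponent. *)
Let C : nat := ((16 * n) ^ n)%N.

Let C_gt0 : (0 < C)%N.
Proof. by rewrite expn_gt0 muln_gt0 n_gt0. Qed.

(** In unit boxes, the potential starts at no more than [2 ^+ n], as [r <= 1], and ends at no less
    than [r ^+ n], as the box around [v] survives. *)
Lemma thicken_decay (r e : R) : 0 < r <= 1 -> 32 * n%:R ^+ 2 * r <= e ->
  r ^+ n <= (1 - C%:R^-1) ^+ (\sum_(t < T) (e <= loss t)%R) * 2 ^+ n.
Proof.
move=> /andP[r0 r1] hr.
have /andP[V0 Voo] := Vol_unit_box R n.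
pose phi t := fine (Vol (thicken (K t) r)).
have mt t : vmeasurable (thicken (K t) r) by exact: vmeasurable_thicken.
have Vfin t : (Vol (thicken (K t) r) <= (2 ^+ n)%:E * Vol (open_box (0%R : 'rV[R]_n) 1%R))%E.
  rewrite -(Vol_open_box (0 : 'rV[R]_n))//; apply: le_Vol => //; first exact: vmeasurable_open_box.
  move=> x [y /knowledge_cube/cube_coord hy xy] i; rewrite mxE subr0.
  have := xy i; have := hy i; have := ler_normD (x 0 i - y 0 i) (y 0 i).
  by rewrite subrK; lra.
have phiE t : Vol (thicken (K t) r) = (phi t)%:E.
  rewrite /phi fineK// ge0_fin_numE ?measure_ge0//.
  by apply: le_lt_trans (Vfin t) _; exact: lte_mul_pinfty.
have VE : Vol (open_box (0 : 'rV[R]_n) 1) = (fine (Vol (open_box (0 : 'rV[R]_n) 1)))%:E.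
  by rewrite fineK// ge0_fin_numE// ltW.
set V := fine _ in VE.
have Vp : 0 < V by rewrite -lte_fin -VE.
have CE : (16 * n%:R)^-1 ^+ n = C%:R^-1 :> R by rewrite exprVn /C natrX natrM.
have phi0 : phi 0 <= 2 ^+ n * V by rewrite -lee_fin -phiE EFinM -VE.
have phiT : r ^+ n * V <= phi T.
  rewrite -lee_fin -phiE EFinM -VE -(Vol_open_box v)//.
  apply: le_Vol => //; first exact: vmeasurable_open_box.
  by move=> x vx; exists v => //; exact: mem_knowledge.
have CR : 1 <= C%:R :> R by rewrite ler1n.
have C1 : 0 <= (C%:R^-1 : R) <= 1.
  by rewrite invr_ge0 (le_trans ler01 CR) invf_le1//; lra.
have dec : phi T <= (1 - C%:R^-1) ^+ (\sum_(t < T) (e <= loss t)%R) * phi 0.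
  apply: (@geometric_decay _ phi (fun t => e <= loss t)) => // t tT.
    rewrite -lee_fin -!phiE; apply: le_Vol => //.
    by apply: thicken_sub; exact: knowledge_subS.
  move=> et; have := @thicken_knowledge R n v us ps T halving v_cube n_gt0
    us_coord t r tT r0 (le_trans hr et).
  rewrite !phiE CE -EFinM -EFinD lee_fin; lra.
have Q0 : 0 <= (1 - C%:R^-1 : R) ^+ (\sum_(t < T) (e <= loss t)%R).
  by apply: exprn_ge0; case/andP: C1; lra.
have h := ler_wpM2l Q0 phi0.
rewrite -(ler_pM2r Vp) -mulrA.
exact: le_trans phiT (le_trans dec h).
Qed.

(* [thicken_decay] with [r = e / (32 n^2)], as [(1 - 1 / C) ^ C <= 1 / 2]. *)
Lemma count_large_loss (j : nat) :
  (\sum_(t < T) ((2 * n%:R) / 2 ^+ j <= loss t)%R <= C * n * (j + 6 + n))%N.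
Proof.
have nR : 1 <= n%:R :> R by rewrite ler1n.
have p2 k : 0 < 2 ^+ k :> R by rewrite exprn_gt0.
have p21 k : 1 <= 2 ^+ k :> R by rewrite exprn_ege1// ler1n.
set N := (\sum_(t < T) _)%N.
pose r : R := (16 * n%:R * 2 ^+ j)^-1.
have n0 : n%:R != 0 :> R by rewrite pnatr_eq0 -lt0n.
have den : 16 <= 16 * n%:R * 2 ^+ j :> R.
  by have := ler_pM ler01 ler01 nR (p21 j); lra.
have hr : 0 < r <= 1.
  by rewrite /r invr_gt0 invf_le1; lra.
have := @thicken_decay r (2 * n%:R / 2 ^+ j) hr.
have -> : 32 * n%:R ^+ 2 * r = 2 * n%:R / 2 ^+ j.
  by rewrite /r; field; rewrite n0 expf_neq0.
move=> /(_ (lexx _)); rewrite -/N => H.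
(* [r / 2] is [1 / (32 n 2^j)], and [n <= 2 ^ n] makes it at least a power of 1/2. *)
have rn : (2 ^+ ((j + 5 + n) * n))^-1 <= (r / 2) ^+ n.
  rewrite exprM -exprVn; apply: lerXn2r; rewrite ?nnegrE ?invr_ge0 ?(ltW (p2 _))//.
    by rewrite divr_ge0//; case/andP: hr => /ltW.
  rewrite /r -invfM lef_pV2 ?posrE ?p2//; last by rewrite mulr_gt0//; lra.
  rewrite exprD exprD; have -> : 2 ^+ 5 = 32 :> R by rewrite -natrX.
  have : n%:R <= 2 ^+ n :> R by rewrite -natrX ler_nat ltnW// ltn_expl.
  by move=> h; have := ler_wpM2l (ltW (p2 j)) h; lra.
have {}H : (r / 2) ^+ n <= (1 - C%:R^-1) ^+ N.
  by rewrite expr_div_n ler_pdivrMr.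
rewrite leqNgt; apply/negP => hN.
have CR : 1 <= C%:R :> R by rewrite ler1n.
have q1 : C%:R^-1 <= 1 :> R by rewrite invf_le1//; lra.
have q0 : 0 <= C%:R^-1 :> R by rewrite invr_ge0; lra.
pose m := ((j + 5 + n) * n)%N.
(* The 6 in the bound, against the 5 in [m], pays for one more halving, which makes the decay
   strictly smaller than [(r / 2) ^+ n]. *)
have hm : (C * m.+1 <= N)%N.
  apply: leq_trans (ltnW hN); rewrite -mulnA leq_mul2l; apply/orP; right.
  by rewrite /m; nia.
have : (1 - C%:R^-1) ^+ N <= (2 ^+ m.+1)^-1 :> R.
  apply: le_trans (_ : (1 - C%:R^-1) ^+ (C * m.+1) <= _).
    by rewrite -(subnK hm) exprD ler_piMl ?exprn_ge0 ?exprn_ile1//; lra.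
  rewrite exprM -exprVn; apply: lerXn2r; rewrite ?nnegrE ?exprn_ge0//; [lra|].
  by have := @half_decay R C C_gt0; lra.
apply/negP; rewrite -ltNge; apply: lt_le_trans (le_trans rn H).
rewrite ltf_pV2 ?posrE ?p2// exprS; have := p2 m; rewrite /m; lra.
Qed.

Lemma total_loss_le :
  \sum_(t < T) loss t <= (1 + 4 * (16 * n) ^ n * n ^ 2 * (n + 7))%:R.
Proof.
have nR : 1 <= n%:R :> R by rewrite ler1n.
pose e j : R := 2 * n%:R / 2 ^+ j.
(* Deep enough that the [T] remainders [2 n / 2 ^+ m] add up to at most 1. *)
pose m := (T + 2 * n)%N.
have e0 : 0 <= 2 * n%:R :> R by rewrite mulr_ge0.
have h t : (t < T)%N -> loss t <= e m + \sum_(j < m.+1) e j * (e j <= loss t)%R%:R.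
  move=> tT; apply: dyadic_layers => //; rewrite normr_ge0/=.
  apply: le_trans (@knowledge_loss_le R n v us ps T halving v_cube us_coord t tT) _.
  by lra.
apply: (@le_trans _ _ (\sum_(t < T) (e m + \sum_(j < m.+1) e j * (e j <= loss t)%R%:R))).
  by apply: ler_sum => t _; apply: h.
rewrite big_split sumr_const card_ord exchange_big /=.
have h1 : e m *+ T <= 1.
  rewrite -mulr_natr /e mulrAC ler_pdivrMr ?exprn_gt0// mul1r.
  rewrite -!natrM -natrX ler_nat /m expnD mulnC leq_mul// ltnW// ltn_expl//.
rewrite natrD; apply: lerD => //.
(* After exchanging the sums, layer [j] contributes its height times the number of rounds that reach
   it. *)
apply: (@le_trans _ _ (\sum_(j < m.+1)
    (2 * n%:R * (C * n)%:R) * ((j%:R + (6 + n)%:R) / 2 ^+ j))).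
  apply: ler_sum => j _; rewrite -mulr_sumr -natr_sum.
  have := count_large_loss j; rewrite -(ler_nat R) => hc.
  apply: (@le_trans _ _ (e j * (C * n * (j + 6 + n))%:R)).
    by apply: ler_wpM2l hc; rewrite /e divr_ge0// exprn_ge0.
  by rewrite /e !natrM !natrD; set q := (2 ^+ j)^-1; lra.
rewrite -mulr_sumr; have h2 := @sum_linear_dyadic R (6 + n)%:R m.+1 (ler0n _ _).
apply: le_trans (ler_wpM2l _ h2) _; first by rewrite mulr_ge0.
rewrite -/C !natrM !natrD; lra.
Qed.
End TotalLoss.

(** * The bound as a power of [d], and its asymptotic form *)

Lemma loss_bound_le d : (1 < d)%N ->
  (1 + 4 * (16 * d) ^ d * d ^ 2 * (d + 7) <= d ^ (9 * d))%N.
Proof.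
move=> d1.
(* Here [16 <= d ^ 4], because [d >= 2]. *)
have h1 : ((16 * d) ^ d <= d ^ (5 * d))%N.
  rewrite expnM leq_exp2r ?(ltnW d1)// expnSr leq_mul//.
  by rewrite -[16%N]/(2 ^ 4)%N leq_exp2r.
(* Taking [d + 8] in place of [d + 7] makes room for the summand 1. *)
have h2 : (4 * d ^ 2 * (d + 8) <= d ^ (4 * d))%N.
  apply: (@leq_trans (d ^ 8)); last by rewrite leq_exp2l//; nia.
  have -> : (d ^ 8 = d ^ 2 * d ^ 2 * d ^ 4)%N by rewrite -!expnD.
  apply: leq_mul; first by rewrite leq_mul2r; apply/orP; right; nia.
  have -> : (d ^ 4 = d * (d * (d * d)))%N by rewrite !expnS expn0 muln1.
  have : (4 <= d * d)%N by nia.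
  have : (2 * (d * d) <= d * (d * d))%N by nia.
  nia.
have p : (0 < (16 * d) ^ d)%N by rewrite expn_gt0 muln_gt0 (ltnW d1).
have -> : (9 * d = 5 * d + 4 * d)%N by nia.
rewrite expnD; apply: leq_trans (leq_mul h1 h2).
have : (1 <= (16 * d) ^ d * (4 * d ^ 2))%N.
  by rewrite !muln_gt0 p (ltnW d1).
by nia.
Qed.

Theorem theorem38 (R : realType) :
  exists f : nat -> R,
    f =O_\oo (fun d : nat => d%:R * ln d%:R) /\
    forall (d : nat), (0 < d)%N ->
    forall (T : nat) (v : 'rV[R]_d) (u : nat -> 'rV[R]_d) (p : nat -> R),
      unit_cube v ->
      (forall t : nat, (t < T)%N -> enorm (u t) = 1) ->
      (forall t : nat, (t < T)%N ->
        Vol (cut_ge (knowledge v u p t) (p t) (u t)) =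
        Vol (cut_le (knowledge v u p t) (p t) (u t))) ->
      \sum_(t < T) symmetric_loss (dotv (u t) v) (p t) <= 2 `^ f d.
Proof.
pose F d : nat := (1 + 4 * (16 * d) ^ d * d ^ 2 * (d + 7))%N.
have ln2 : 0 < ln 2 :> R by rewrite ln_gt0// ltr1n.
have F1 d : 1 <= (F d)%:R :> R by rewrite ler1n.
(* The base-2 logarithm, so that [2] to this power is exactly [F d]. *)
exists (fun d => ln (F d)%:R / ln 2); split; last first.
  move=> d d0 T v u p hv hu hp.
  rewrite /powR pnatr_eq0 /= divfK ?gt_eqF// lnK; last by rewrite posrE; apply: lt_le_trans (F1 d).
  apply: total_loss_le => // t tT i.
  by apply: enorm1_coord; exact: hu.
apply/eqO_exP; exists (9 / ln 2); first by rewrite divr_gt0.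
(* The comparison starts at 2, as [d * ln d] vanishes at 1 while [F 1 > 1]. *)
exists 2%N => // d /= d2.
have dR : 1 < d%:R :> R by rewrite ltr1n.
have lnd : 0 < ln d%:R :> R by rewrite ln_gt0.
rewrite !ger0_norm; last 2 first.
- by rewrite mulr_ge0// ltW.
- by rewrite divr_ge0 ?(ltW ln2)// ln_ge0.
have h : ln (F d)%:R <= 9 * (d%:R * ln d%:R) :> R.
  have -> : 9 * (d%:R * ln d%:R) = ln (d%:R ^+ (9 * d)) :> R.
    by rewrite lnXn ?(lt_trans _ dR)// -(mulr_natl (ln _)) natrM mulrA.
  rewrite ler_ln ?posrE ?(lt_le_trans _ (F1 d))//; last by rewrite exprn_gt0// (lt_trans _ dR).
  by rewrite -natrX ler_nat loss_bound_le.
by rewrite mulrAC ler_pM2r ?invr_gt0.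
Qed.
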